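(* Let $R$ be a commutative ring with identity, let $M$ be a fully pure multiplication $R$-module and let $N$ be a submodule of $M$. Then the following conditions are equivalent: (a) $N$ is a strongly 2-irreducible submodule of $M$; (b) $N$ is a 2-absorbing submodule of $M$; (c) $N$ is a 2-irreducible submodule of $M$.
   Context: An $R$-module $M$ is a multiplication module if for every submodule $N$ of $M$ there is an ideal $I$ of $R$ with $N=IM$. A submodule $N$ of $M$ is pure if $IN=IM\cap N$ for every ideal $I$ of $R$; $M$ is fully pure if every submodule of $M$ is pure. $(N:_RM)=\{r\in R: rM\subseteq N\}$. A proper submodule $N$ of $M$ is strongly 2-irreducible if whenever $H_1\cap H_2\cap H_3\subseteq N$ for submodules $H_1,H_2,H_3$ of $M$, then $H_1\cap H_2\subseteq N$ or $H_2\cap H_3\subseteq N$ or $H_1\cap H_3\subseteq N$. A proper submodule $N$ of $M$ is 2-absorbing if whenever $abm\in N$ with $a,b\in R$, $m\in M$, then $am\in N$ or $bm\in N$ or $ab\in(N:_RM)$. A submodule $N$ of $M$ is 2-irreducible if whenever $N=H_1\cap H_2\cap H_3$ for submodules $H_1,H_2,H_3$ of $M$, then $N=H_1\cap H_2$ or $N=H_2\cap H_3$ or $N=H_1\cap H_3$.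
   Formalization: N is assumed to be a proper submodule: for N = M, condition (c) as defined holds trivially while (a) and (b) fail because they require properness, so the equivalence is false in that one case. *)

(* Defs.v *)
From mathcomp Require Import all_boot all_algebra.
From mathcomp Require Import boolp classical_sets.

Set Implicit Arguments.
Unset Strict Implicit.
Unset Printing Implicit Defensive.

Import GRing.Theory.
Local Open Scope ring_scope.
Local Open Scope classical_set_scope.

(* Rings may be zero (comPzRingType), and submodules are Prop-valued sets.    *)
Definition submodule (R : comPzRingType) (M : lmodType R) (N : set M) : Prop :=
  submod_closed [pred x in N].

Lemma submoduleP (R : comPzRingType) (M : lmodType R) (N : set M) :
  submodule N <->
  N 0 /\ forall (a : R) (u v : M), N u -> N v -> N (a *: u + v).
Proof.
split=> -[N0 Nlin]; split.
- by move: N0; rewrite !inE.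
- by move=> a u v Nu Nv; move: (Nlin a u v); rewrite !inE; apply.
- by rewrite !inE.
- by move=> a u v; rewrite !inE; apply: Nlin.
Qed.

(* Ideals are the submodules of the regular module; unlike the library's      *)
(* idealr_closed, this does not exclude the unit ideal.                       *)
Definition ideal (R : comPzRingType) (I : set R) : Prop :=
  submodule (I : set R^o).

Definition proper_submodule (R : comPzRingType) (M : lmodType R) (N : set M) :
    Prop :=
  submodule N /\ N <> setT.

(* The submodule IN: finite sums of products, n = 0 giving the zero vector.   *)
Definition ideal_mul (R : comPzRingType) (M : lmodType R)
    (I : set R) (N : set M) : set M :=
  [set x | exists (n : nat) (a : 'I_n -> R) (m : 'I_n -> M),
     (forall i, I (a i)) /\ (forall i, N (m i)) /\ x = \sum_(i < n) a i *: m i].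

(* (N :_R M) *)
Definition residual (R : comPzRingType) (M : lmodType R) (N : set M) : set R :=
  [set r | [set r *: m | m in [set: M]] `<=` N].

Definition multiplication_module (R : comPzRingType) (M : lmodType R) : Prop :=
  forall N : set M, submodule N ->
    exists2 I : set R, ideal I & N = ideal_mul I [set: M].

Definition pure_submodule (R : comPzRingType) (M : lmodType R) (N : set M) :
    Prop :=
  submodule N /\
  forall I : set R, ideal I -> ideal_mul I N = ideal_mul I [set: M] `&` N.

Definition fully_pure (R : comPzRingType) (M : lmodType R) : Prop :=
  forall N : set M, submodule N -> pure_submodule N.

Definition strongly_2_irreducible (R : comPzRingType) (M : lmodType R)
    (N : set M) : Prop :=
  proper_submodule N /\
  forall H1 H2 H3 : set M, submodule H1 -> submodule H2 -> submodule H3 ->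
    H1 `&` H2 `&` H3 `<=` N ->
    [\/ H1 `&` H2 `<=` N, H2 `&` H3 `<=` N | H1 `&` H3 `<=` N].

Definition two_absorbing (R : comPzRingType) (M : lmodType R) (N : set M) :
    Prop :=
  proper_submodule N /\
  forall (a b : R) (m : M), N ((a * b) *: m) ->
    [\/ N (a *: m), N (b *: m) | residual N (a * b)].

(* Properness is not required here, so N = M is always 2-irreducible.         *)
Definition two_irreducible (R : comPzRingType) (M : lmodType R) (N : set M) :
    Prop :=
  submodule N /\
  forall H1 H2 H3 : set M, submodule H1 -> submodule H2 -> submodule H3 ->
    N = H1 `&` H2 `&` H3 ->
    [\/ N = H1 `&` H2, N = H2 `&` H3 | N = H1 `&` H3].

(* Main.v *)
Require Import Defs.
From mathcomp Require Import all_boot all_algebra.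
From mathcomp Require Import boolp classical_sets.

(* In a fully pure multiplication module every x has a scalar e that fixes x  *)
(* and maps M into Rx: write Rx = IM, so that Rx = IM `&` Rx = I(Rx). These   *)
(* scalars behave like idempotents and make the lattice of submodules         *)
(* distributive, which gives (a) <-> (c). For (b) -> (a), choose x, y, z      *)
(* outside N in the three pairwise intersections, with scalars e, f, g; then  *)
(* ey, fx, ez, fz lie in N, and (1 - e)(1 - f) kills x + y although neither   *)
(* factor sends x + y into N and the product does not send z into N.          *)

Import GRing.Theory.
Local Open Scope ring_scope.
Local Open Scope classical_set_scope.

(** Both hypotheses on [M] enter only through the scalars of [local_unit]. For (c) -> (a), if H1,
    H2, H3 meet inside [N], distributivity gives that [N] is the intersection of the submodules N +
    Hi; then [N] is already the intersection of two of them, hence contains the matching Hi and Hj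
    intersected. For (a) -> (b), irreducibility is applied to aM, bM and Rm, whose intersection lies
    in R(abm). *)

Section Submodules.
Context {R : comPzRingType} {M : lmodType R}.
Implicit Types (N H : set M) (u v x : M) (a : R).

Lemma submoduleD N u v : submodule N -> N u -> N v -> N (u + v).
Proof. by move=> /submoduleP[_ lin] Nu Nv; rewrite -[u]scale1r; apply: lin. Qed.

Lemma submoduleZ N a u : submodule N -> N u -> N (a *: u).
Proof.
by move=> /submoduleP[N0 lin] Nu; rewrite -[_ *: _]addr0; apply: lin.
Qed.

Lemma submoduleB N u v : submodule N -> N u -> N v -> N (u - v).
Proof.
by move=> sN Nu Nv; rewrite -scaleN1r; apply: submoduleD => //; apply: submoduleZ.
Qed.

Lemma submoduleBK N u v : submodule N -> N (u - v) -> N v -> N u.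
Proof. by move=> sN Nuv Nv; rewrite -(subrK v u); apply: submoduleD. Qed.

Lemma submodule_cyclic x : submodule [set a *: x | a in [set: R]].
Proof.
apply/submoduleP; split; first by exists 0; rewrite ?scale0r.
by move=> a _ _ [b _ <-] [c _ <-]; exists (a * b + c); rewrite ?scalerDl ?scalerA.
Qed.

Lemma submodule_dilation a : submodule [set a *: u | u in [set: M]].
Proof.
apply/submoduleP; split; first by exists 0; rewrite ?scaler0.
move=> b _ _ [u _ <-] [v _ <-]; exists (b *: u + v) => //.
by rewrite scalerDr !scalerA mulrC.
Qed.

Lemma submodule_sum H1 H2 :
  submodule H1 -> submodule H2 -> submodule [set u + v | u in H1 & v in H2].
Proof.
move=> /submoduleP[H10 lin1] /submoduleP[H20 lin2]; apply/submoduleP; split.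
  by exists 0 => //; exists 0 => //; rewrite addr0.
move=> a _ _ [u1 Hu1 [v1 Hv1 <-]] [u2 Hu2 [v2 Hv2 <-]].
exists (a *: u1 + u2); first exact: lin1.
exists (a *: v1 + v2); first exact: lin2.
by rewrite scalerDr addrACA.
Qed.

Lemma strongly_2_irreducible_2_irreducible N :
  strongly_2_irreducible N -> two_irreducible N.
Proof.
move=> [[sN _] irrN]; split=> // H1 H2 H3 sH1 sH2 sH3 defN.
have subN : H1 `&` H2 `&` H3 `<=` N by rewrite -defN.
have [H12 | H23 | H13] := irrN _ _ _ sH1 sH2 sH3 subN.
- by constructor 1; apply/seteqP; split=> // u; rewrite defN => -[].
- by constructor 2; apply/seteqP; split=> // u; rewrite defN => -[[]].
- by constructor 3; apply/seteqP; split=> // u; rewrite defN => -[[]].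
Qed.

End Submodules.

Section FullyPureMultiplication.
Context {R : comPzRingType} {M : lmodType R}.
Context (M_fully_pure : fully_pure M) (M_mult : multiplication_module M).
Implicit Types (N H : set M) (x v : M).

Lemma local_unit x :
  exists2 e : R, e *: x = x & forall m : M, exists r : R, e *: m = r *: x.
Proof.
have sRx := submodule_cyclic x.
have [I idI defRx] := M_mult _ sRx.
have [_ /(_ I idI) pureRx] := M_fully_pure _ sRx.
have : [set a *: x | a in [set: R]] x by exists 1; rewrite ?scale1r.
(* Purity of Rx turns Rx = IM into Rx = I(Rx), so x is a sum of terms a_i (r_i x) with a_i in [I].
   The scalar e is the sum of the a_i r_i; it lies in [I], whence eM is inside IM = Rx. *)
rewrite -[X in X x]setIid {1}defRx -pureRx => -[n [a [m [Ia [Rxm defx]]]]].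
have [r defm] : {r : 'I_n -> R & forall i, r i *: x = m i}.
  apply: (@choice _ _ (fun i s => s *: x = m i)) => i.
  by have [s _ <-] := Rxm i; exists s.
exists (\sum_i a i * r i).
  by rewrite scaler_suml {2}defx; apply: eq_bigr => i _; rewrite -scalerA defm.
move=> u.
have : ideal_mul I [set: M] ((\sum_i a i * r i) *: u).
  exists n, a, (fun i => r i *: u); split=> //; split=> //.
  by rewrite scaler_suml; apply: eq_bigr => i _; rewrite -scalerA.
by rewrite -defRx => -[s _ <-]; exists s.
Qed.

(* Distributivity: Rv `&` (N + H) is contained in N + (Rv `&` H). *)
Lemma cyclic_modular N H v :
  submodule N -> submodule H -> [set n + h | n in N & h in H] v ->
  exists r : R, H (r *: v) /\ N (v - r *: v).
Proof.
move=> sN sH [n Nn [h Hh defv]].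
(* Since e fixes v, v = e n + e h with e h = r v, so v - r v = e n. *)
have [e ev eM] := local_unit v; have [r eh] := eM h.
exists r; rewrite -eh; split; first exact: submoduleZ.
by rewrite -{1}ev -{1}defv scalerDr addrK; apply: submoduleZ.
Qed.

(** Modulo [N], v is replaced by a multiple in H1, then by a further multiple in H2, then in H3.
    Multiples stay in the earlier submodules, so the last one lies in all three and hence in [N]. *)
Lemma sum_setI3_subset N H1 H2 H3 :
  submodule N -> submodule H1 -> submodule H2 -> submodule H3 ->
  H1 `&` H2 `&` H3 `<=` N ->
  [set n + h | n in N & h in H1] `&` [set n + h | n in N & h in H2]
    `&` [set n + h | n in N & h in H3] `<=` N.
Proof.
move=> sN sH1 sH2 sH3 sHN v [[NH1v NH2v] NH3v].
have [r [H1r Nr]] := cyclic_modular _ _ _ sN sH1 NH1v.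
apply: (submoduleBK _ _ _ sN Nr).
have [s [H2s Ns]] := cyclic_modular _ _ _ sN sH2
  (submoduleZ _ r _ (submodule_sum _ _ sN sH2) NH2v).
apply: (submoduleBK _ _ _ sN Ns).
have [t [H3t Nt]] := cyclic_modular _ _ _ sN sH3
  (submoduleZ _ s _ (submodule_sum _ _ sN sH3)
    (submoduleZ _ r _ (submodule_sum _ _ sN sH3) NH3v)).
apply: (submoduleBK _ _ _ sN Nt).
by apply: sHN; split=> //; split; do 2?[done | apply: submoduleZ => //].
Qed.

Lemma two_irreducible_strongly_2_irreducible N :
  proper_submodule N -> two_irreducible N -> strongly_2_irreducible N.
Proof.
move=> pN [sN irrN]; split=> // H1 H2 H3 sH1 sH2 sH3 sHN.
pose S H := [set n + h | n in N & h in H].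
have sS H : submodule H -> submodule (S H) by exact: submodule_sum.
have NS H : submodule H -> N `<=` S H.
  by move=> /submoduleP[H0 _] n Nn; exists n => //; exists 0 => //; rewrite addr0.
have HS H : H `<=` S H.
  have /submoduleP[N0 _] := sN.
  by move=> h Hh; exists 0 => //; exists h => //; rewrite add0r.
have defN : N = S H1 `&` S H2 `&` S H3.
  apply/seteqP; split; last exact: sum_setI3_subset.
  by move=> n Nn; split; first split; apply: NS.
have := irrN _ _ _ (sS _ sH1) (sS _ sH2) (sS _ sH3) defN.
by case=> ->; [constructor 1 | constructor 2 | constructor 3]; apply: setISS.
Qed.

Lemma strongly_2_irreducible_2_absorbing N :
  strongly_2_irreducible N -> two_absorbing N.
Proof.
move=> [pN irrN]; split=> // a b m Nabm; have [sN _] := pN.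
have sub : [set a *: u | u in [set: M]] `&` [set b *: u | u in [set: M]]
    `&` [set r *: m | r in [set: R]] `<=` N.
  move=> v [[[p _ defap] [q _ defbq]] [r _ defrm]].
  (* Here v = ap = bq = rm. As e p = s v, v = e v = a (e p) = (as) v; likewise v = (bt) v. Hence v =
     (as)(bt) r m is a multiple of abm. *)
  have [e ev eM] := local_unit v.
  have [s eps] := eM p; have [t eqt] := eM q.
  have va : v = (a * s) *: v.
    by rewrite -scalerA -eps scalerA mulrC -scalerA defap.
  have vb : v = (b * t) *: v.
    by rewrite -scalerA -eqt scalerA mulrC -scalerA defbq.
  have -> : v = (s * t * r) *: ((a * b) *: m).
    rewrite {1}va {1}vb -defrm !scalerA; congr (_ *: _).
    by rewrite mulrACA [RHS]mulrC -!mulrA.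
  exact: submoduleZ.
have [] := irrN _ _ _ (submodule_dilation a) (submodule_dilation b)
  (submodule_cyclic m) sub => sub2.
- constructor 3 => _ [u _ <-]; apply: sub2; split.
    by exists (b *: u); rewrite ?scalerA.
  by exists (a *: u); rewrite ?scalerA // mulrC.
- by constructor 2; apply: sub2; split; [exists m | exists b].
- by constructor 1; apply: sub2; split; [exists m | exists a].
Qed.

Lemma two_absorbing_strongly_2_irreducible N :
  two_absorbing N -> strongly_2_irreducible N.
Proof.
move=> [pN absN]; split=> // H1 H2 H3 sH1 sH2 sH3 sHN; have [sN _] := pN.
have [|/existsNP[x /not_implyP[[H1x H2x] Nx]]] := pselect (H1 `&` H2 `<=` N).
  by constructor 1.
have [|/existsNP[y /not_implyP[[H2y H3y] Ny]]] := pselect (H2 `&` H3 `<=` N).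
  by constructor 2.
have [|/existsNP[z /not_implyP[[H1z H3z] Nz]]] := pselect (H1 `&` H3 `<=` N).
  by constructor 3.
exfalso.
have [e ex eM] := local_unit x; have [f fy fM] := local_unit y.
(* In this and the next three facts, e sends everything into Rx, inside H1 and H2, and f into Ry,
   inside H2 and H3; this supplies the one missing membership. *)
have Ney : N (e *: y).
  apply: sHN; split; [split|]; [|exact: submoduleZ..].
  by have [r ->] := eM y; apply: submoduleZ.
have Nfx : N (f *: x).
  apply: sHN; split; [split; exact: submoduleZ|].
  by have [r ->] := fM x; apply: submoduleZ.
have Nez : N (e *: z).
  apply: sHN; split; [split; [exact: submoduleZ|]|exact: submoduleZ].
  by have [r ->] := eM z; apply: submoduleZ.
have Nfz : N (f *: z).
  apply: sHN; split; [split; [exact: submoduleZ|]|exact: submoduleZ].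
  by have [r ->] := fM z; apply: submoduleZ.
have ann_x : (1 - e) *: x = 0 by rewrite scalerBl scale1r ex subrr.
have ann_y : (1 - f) *: y = 0 by rewrite scalerBl scale1r fy subrr.
have Nxy : N (((1 - e) * (1 - f)) *: (x + y)).
  rewrite scalerDr -[X in _ + X]scalerA ann_y scaler0 addr0.
  by rewrite mulrC -scalerA ann_x scaler0; have /submoduleP[] := sN.
have [] := absN _ _ _ Nxy.
- rewrite scalerDr ann_x add0r scalerBl scale1r => Nyy.
  by apply: Ny; apply: submoduleBK Nyy Ney.
- rewrite scalerDr ann_y addr0 scalerBl scale1r => Nxx.
  by apply: Nx; apply: submoduleBK Nxx Nfx.
- move=> /(_ (((1 - e) * (1 - f)) *: z)) Nzz.
  have {Nzz} : N (((1 - e) * (1 - f)) *: z) by apply: Nzz; exists z.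
  (* With w = z - e z, the hypothesis says w - f w is in [N]. Since f w = f z - f (e z) is in [N],
     so is w, and then z, a contradiction. *)
  rewrite mulrC -scalerA [(1 - e) *: z]scalerBl scale1r => Nzz.
  apply: Nz; apply: (submoduleBK _ _ (e *: z)) => //.
  rewrite scalerBl scale1r in Nzz; apply: (submoduleBK _ _ _ sN Nzz).
  rewrite scalerBr; apply: submoduleB => //.
  exact: submoduleZ.
Qed.

End FullyPureMultiplication.

Theorem theorem2p19 (R : comPzRingType) (M : lmodType R)
  (M_fully_pure : fully_pure M) (M_mult : multiplication_module M)
  (N : set M) (N_proper : proper_submodule N) :
  (strongly_2_irreducible N <-> two_absorbing N) /\
  (two_absorbing N <-> two_irreducible N).
Proof.
have ab : strongly_2_irreducible N <-> two_absorbing N.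
  split; first exact: strongly_2_irreducible_2_absorbing.
  exact: two_absorbing_strongly_2_irreducible.
split=> //; rewrite -ab; split; first exact: strongly_2_irreducible_2_irreducible.
exact: two_irreducible_strongly_2_irreducible.
Qed.
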